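(* Let $G$ be a semi-simple Lie group with Lie algebra $\mathfrak g$. Then every prederivation of the Lie algebra $T^*\mathfrak g$ of the cotangent bundle Lie group $T^*G$ of $G$ is a derivation.
   Context: Lie groups and Lie algebras are real and finite dimensional. A prederivation of a Lie algebra $\mathfrak h$ is a linear map $p:\mathfrak h\to\mathfrak h$ with $p([x,[y,z]])=[p(x),[y,z]]+[x,[p(y),z]]+[x,[y,p(z)]]$ for all $x,y,z\in\mathfrak h$. $T^*G$ has the Lie group structure of the semi-direct product $G\ltimes\mathfrak g^*$ via the coadjoint action of $G$ on the abelian group $\mathfrak g^*$; its Lie algebra $T^*\mathfrak g=\mathfrak g\ltimes\mathfrak g^*$ has bracket $[(x,f),(y,g)]=([x,y],\,ad^*_xg-ad^*_yf)$, where $ad^*_xf=-f\circ ad_x$. *)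

(* Defs.v *)
From HB Require Import structures.
From mathcomp Require Import all_boot all_order all_algebra ring.

Set Implicit Arguments.
Unset Strict Implicit.
Unset Printing Implicit Defensive.

Import GRing.Theory.
Local Open Scope ring_scope.

(* The carrier is a vectType, so that Lie algebras are finite dimensional. *)
HB.mixin Record Vector_isLieAlgebra (K : fieldType) V of Vector K V := {
  lie : V -> V -> V;
  lieDl : forall x y z, lie (x + y) z = lie x z + lie y z;
  lieDr : forall x y z, lie x (y + z) = lie x y + lie x z;
  lieZl : forall (a : K) x y, lie (a *: x) y = a *: lie x y;
  lieZr : forall (a : K) x y, lie x (a *: y) = a *: lie x y;
  lie_alt : forall x, lie x x = 0;
  lie_jacobi : forall x y z,
    lie x (lie y z) + lie y (lie z x) + lie z (lie x y) = 0
}.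

#[short(type="lieAlgType")]
HB.structure Definition LieAlgebra (K : fieldType) :=
  {V of Vector_isLieAlgebra K V & Vector K V}.

Notation "[ 'lie' x , y ]" := (lie x y)
  (at level 0, x, y at level 200, format "[ 'lie'  x ,  y ]") : ring_scope.

Section LieAlgebraTheory.
Variables (K : fieldType) (g : lieAlgType K).
Implicit Types (x y z : g) (U V W I : {vspace g}).

Lemma lieC x y : [lie x, y] = - [lie y, x].
Proof.
apply/eqP; rewrite -addr_eq0; apply/eqP.
by have := lie_alt (x + y); rewrite lieDl !lieDr !lie_alt add0r addr0.
Qed.

Fact lie_is_linear x : linear (lie x).
Proof. by move=> a y z; rewrite lieDr lieZr. Qed.
HB.instance Definition _ x :=
  GRing.isLinear.Build K g g *:%R (lie x) (lie_is_linear x).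

Definition ad x : 'End(g) := linfun (lie x).

Lemma adE x y : ad x y = [lie x, y].
Proof. by rewrite lfunE. Qed.

Definition derivation (d : 'End(g)) : Prop :=
  forall x y, d [lie x, y] = [lie d x, y] + [lie x, d y].

Definition prederivation (p : 'End(g)) : Prop :=
  forall x y z, p [lie x, [lie y, z]] =
    [lie p x, [lie y, z]] + [lie x, [lie p y, z]] + [lie x, [lie y, p z]].

(* The bracket of two subspaces, i.e. the span of all brackets (liev_subP);
   as for prodv, brackets of basis vectors suffice. *)
Definition liev U V : {vspace g} := <<allpairs lie (vbasis U) (vbasis V)>>%VS.

Lemma memv_lie U V x y : x \in U -> y \in V -> [lie x, y] \in liev U V.
Proof.
move=> /coord_vbasis-> /coord_vbasis->.
rewrite linear_sum; apply: memv_suml => j _; rewrite linearZ memvZ //=.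
rewrite lieC rpredN linear_sum; apply: memv_suml => i _.
rewrite linearZ memvZ //= lieC rpredN memv_span //.
by apply: allpairs_f; rewrite mem_nth ?size_tuple.
Qed.

Lemma liev_subP U V W :
  reflect (forall x y, x \in U -> y \in V -> [lie x, y] \in W)
          (liev U V <= W)%VS.
Proof.
apply: (iffP idP) => [/subvP sUVW x y Ux Vy | UVW].
  exact/sUVW/memv_lie.
by apply/span_subvP=> _ /allpairsP[[x y] /= [Ux Vy ->]]; rewrite UVW ?vbasis_mem.
Qed.

Definition lie_ideal I : Prop :=
  forall x y, y \in I -> [lie x, y] \in I.

Definition derived_series n U : {vspace g} := iter n (fun V => liev V V) U.

Definition lie_solvable U : Prop := exists n, derived_series n U = 0%VS.

(* Semi-simplicity: the radical, i.e. the largest solvable ideal, is zero. *)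
Definition semisimple : Prop :=
  forall I, lie_ideal I -> lie_solvable I -> I = 0%VS.

(* Linear forms are elements of 'Hom(g, K^o). *)
Definition coad x (f : 'Hom(g, K^o)) : 'Hom(g, K^o) := - (f \o ad x)%VF.

Lemma coadE x f y : coad x f y = - f [lie x, y].
Proof. by rewrite opp_lfunE comp_lfunE adE. Qed.

End LieAlgebraTheory.

Arguments semisimple {K} g.

(* The semi-direct product of g and g^* for the coadjoint representation, with
   g^* abelian: the Lie algebra of the cotangent bundle T^*G of a Lie group G
   with Lie algebra g, trivialised as the semi-direct product of G and g^*. *)
Definition cotangent (K : fieldType) (g : lieAlgType K) : Type :=
  (g * 'Hom(g, K^o))%type.

Section Cotangent.
Variables (K : fieldType) (g : lieAlgType K).
Implicit Types u v w : cotangent g.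

HB.instance Definition _ := Vector.on (cotangent g).

Definition cotangent_lie u v : cotangent g :=
  ([lie u.1, v.1], coad u.1 v.2 - coad v.1 u.2).

Let eq_cot u v : u.1 = v.1 -> (forall z, u.2 z = v.2 z) -> u = v.
Proof. by case: u v => [x f] [y h] /= -> /lfunP->. Qed.

Lemma cotangent_lie2E u v z :
  (cotangent_lie u v).2 z = u.2 [lie v.1, z] - v.2 [lie u.1, z].
Proof. by rewrite add_lfunE coadE [X in _ + X]opp_lfunE coadE opprK addrC. Qed.

Let cot2D u v z : (u + v).2 z = u.2 z + v.2 z. Proof. exact: add_lfunE. Qed.
Let cot2N u z : (- u).2 z = - u.2 z. Proof. exact: opp_lfunE. Qed.
Let cot2Z a u z : (a *: u).2 z = a *: u.2 z. Proof. exact: scale_lfunE. Qed.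
Let cotE := (cot2D, cot2N, cot2Z, cotangent_lie2E).

Fact cotangent_lieDr u v w :
  cotangent_lie u (v + w) = cotangent_lie u v + cotangent_lie u w.
Proof.
apply: eq_cot => [|z]; first exact: lieDr.
rewrite !cotE /= lieDl linearD /=.
by rewrite opprD addrACA.
Qed.

Fact cotangent_lieZr (a : K) u v :
  cotangent_lie u (a *: v) = a *: cotangent_lie u v.
Proof.
apply: eq_cot => [|z]; first exact: lieZr.
by rewrite !cotE /= lieZl linearZ -scalerBr.
Qed.

Fact cotangent_lie_alt u : cotangent_lie u u = 0.
Proof. by rewrite /cotangent_lie lie_alt subrr. Qed.

Fact cotangent_lieC u v : cotangent_lie u v = - cotangent_lie v u.
Proof.
apply: eq_cot => [|z]; first exact: lieC.
by rewrite !cotE opprB.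
Qed.

Fact cotangent_lieDl u v w :
  cotangent_lie (u + v) w = cotangent_lie u w + cotangent_lie v w.
Proof. by rewrite !(cotangent_lieC _ w) cotangent_lieDr opprD. Qed.

Fact cotangent_lieZl (a : K) u v :
  cotangent_lie (a *: u) v = a *: cotangent_lie u v.
Proof. by rewrite !(cotangent_lieC _ v) cotangent_lieZr scalerN. Qed.

Fact cotangent_lie_jacobi u v w :
  cotangent_lie u (cotangent_lie v w) + cotangent_lie v (cotangent_lie w u)
    + cotangent_lie w (cotangent_lie u v) = 0.
Proof.
have jac (x y z : g) : [lie [lie x, y], z] =
    [lie x, [lie y, z]] - [lie y, [lie x, z]].
  rewrite lieC (lieC x z) linearN /= opprK; apply/eqP.
  by rewrite eq_sym -subr_eq0 opprK lie_jacobi.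
apply: eq_cot => [|z]; first exact: lie_jacobi.
rewrite !cotE /= !jac !linearB /= zero_lfunE.
ring.
Qed.

HB.instance Definition _ := Vector_isLieAlgebra.Build K (cotangent g)
  cotangent_lieDl cotangent_lieDr cotangent_lieZl cotangent_lieZr
  cotangent_lie_alt cotangent_lie_jacobi.

Lemma cotangent_lieE u v :
  [lie u, v] = ([lie u.1, v.1], coad u.1 v.2 - coad v.1 u.2).
Proof. by []. Qed.

End Cotangent.

(* Main.v *)
Require Import Defs.
From HB Require Import structures.
From mathcomp Require Import all_boot all_order all_algebra reals.
From mathcomp Require Import complex ring.

Set Implicit Arguments.
Unset Strict Implicit.
Unset Printing Implicit Defensive.

Import VectorInternalTheory.
Import Order.TTheory GRing.Theory Num.Theory.
Local Open Scope ring_scope.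

(** The theorem rests on a fact about an arbitrary Lie algebra [L] in which 2
    is invertible: if [L] is perfect and has trivial centre, then every
    prederivation [p] of [L] is a derivation ([prederivation_derivation]).  For
    a sum [x] of brackets [[a, b]] put [d x := sum of [p a, b] + [a, p b]].  The
    prederivation identity says [p [z, x] = [p z, x] + [z, d x]] for all [z], so
    [d x] is determined by [x] because the centre is trivial.  The defect
    [e := p - d] then satisfies [e [z, x] = - [z, e x]], and the Jacobi identity
    turns this into [2 [[u, v], e x] = 0]; as [L] is perfect, [e x] is central,
    hence zero, and [p = d] on [L].

    It remains to see that the cotangent algebra of [g] is perfect and
    centreless when [g] is semisimple.  Both follow from the nondegeneracy of
    the Killing form of [g] ([semisimple_killing]): it gives that [g] is
    centreless and perfect, and, identifying [g] with its dual, that the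
    coadjoint action of [g] spans the dual ([cotangent_perfect]).

    Since semisimple means here that the radical is zero, nondegeneracy is
    Cartan's criterion.  The radical [I] of the Killing form is an ideal, and
    its derived series ends in a perfect subalgebra [J]; if [J] is zero, [I] is
    solvable, hence zero.  Let [a] be in [J] and [A := ad a].  Over the complex
    numbers, let [y] act on each generalised eigenspace of [A] as the conjugate
    of the eigenvalue.  Then the trace of [A y] is the sum of the squared moduli
    of the eigenvalues, while the commutator with [y] is a polynomial in the
    commutator with [A].  The latter property survives taking real parts, and
    implies that the commutator with [y] maps [ad J] to itself
    ([conj_semisimple_part]).  Writing [a] as a sum of brackets of elements of
    [J], the trace of [A y] becomes a sum of values of the Killing form on [J],
    which vanish ([mxtrace_admx_perfect]).  So every eigenvalue of [ad a] is
    zero.  By Engel's theorem a perfect algebra of ad-nilpotent elements is zero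
    ([engel_perfect_eq0]). *)

(** * Interpolation modulo powers of linear polynomials *)

Section Interpolation.
Variable F : fieldType.
Implicit Types (s : seq F) (N : nat).

Lemma coprimep_prod_XsubC s a N : a \notin s ->
  coprimep (('X - a%:P) ^+ N) (\prod_(b <- s) ('X - b%:P) ^+ N).
Proof.
elim: s => [|b s IH]; first by rewrite big_nil coprimep1.
rewrite inE negb_or big_cons => /andP[ab sa]; rewrite coprimepMr IH // andbT.
by rewrite coprimep_expl // coprimep_expr // coprimep_XsubC root_XsubC eq_sym.
Qed.

(** The Chinese remainder theorem, by induction on the nodes: a Bezout
    coefficient corrects the value at the new node without disturbing the
    others. *)
Lemma interpolation_mod_powers s N (f : F -> F) :
  exists q, {in s, forall a, ('X - a%:P) ^+ N %| q - (f a)%:P}.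
Proof.
elim: s => [|a s [q qP]]; first by exists 0.
have [sa|sNa] := boolP (a \in s).
  by exists q => b; rewrite inE => /predU1P[->|]; apply: qP.
have /Bezout_eq1_coprimepP[[u v] /= uv1] := coprimep_prod_XsubC N sNa.
set U := ('X - _) ^+ N in uv1; set V := \prod_(b <- s) _ in uv1.
exists (q + v * V * ((f a)%:P - q)) => b; rewrite inE => /predU1P[->|sb].
  have -> : q + v * V * ((f a)%:P - q) - (f a)%:P = u * (q - (f a)%:P) * U.
    by have -> : v * V = 1 - u * U by [rewrite -uv1 addrC addKr]; ring.
  exact: dvdp_mull.
rewrite addrAC dvdp_addr ?qP // dvdp_mulr // dvdp_mull //.
by rewrite /V (big_rem b) //= dvdp_mulr.
Qed.

(** [size s] bounds the multiplicity of each [a] in [s], so it is an exponent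
    that serves all of them at once. *)
Lemma dvdp_prod_XsubC_powers s (r : {poly F}) :
  {in s, forall a, ('X - a%:P) ^+ size s %| r} ->
  \prod_(a <- s) ('X - a%:P) %| r.
Proof.
move=> sr; apply: (@dvdp_trans _ (\prod_(a <- undup s) ('X - a%:P) ^+ size s)).
  rewrite -prodr_undup_exp_count; elim/big_rec2: _ => // a u v _ uv.
  by rewrite dvdp_mul // dvdp_exp2l // count_size.
have: {in undup s, forall a, ('X - a%:P) ^+ size s %| r}.
  by move=> a; rewrite mem_undup; apply: sr.
elim: (undup s) (undup_uniq s) => [|a t IH] /=; first by rewrite big_nil dvd1p.
case/andP=> ta ut tr; rewrite big_cons Gauss_dvdp ?coprimep_prod_XsubC //.
rewrite tr ?mem_head //= IH // => b tb.
by rewrite tr // inE tb orbT.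
Qed.

End Interpolation.

(** * Polynomials of a linear operator *)

Section PolynomialOfOperator.
Variables (F : fieldType) (V : lmodType F).
Implicit Types (P Q : {poly F}) (T : V -> V) (v : V).

(** Defined on bare functions, so that the same polynomial can be applied to
    [ad a] on a Lie algebra and to the corresponding commutator on matrices. *)
Definition polyop (P : {poly F}) (T : V -> V) (v : V) : V :=
  \sum_(k < size P) P`_k *: iter k T v.

Lemma polyopE n P T v : (size P <= n)%N ->
  polyop P T v = \sum_(k < n) P`_k *: iter k T v.
Proof.
move=> sPn; rewrite /polyop (big_ord_widen n (fun k => P`_k *: iter k T v)) //.
rewrite big_mkcond; apply: eq_bigr => k _; case: ltnP => // sPk.
by rewrite nth_default // scale0r.
Qed.

Lemma polyopD P Q T v : polyop (P + Q) T v = polyop P T v + polyop Q T v.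
Proof.
rewrite !(@polyopE (maxn (size P) (size Q))) ?leq_maxl ?leq_maxr //; last first.
  exact: size_polyD.
by rewrite -big_split; apply: eq_bigr => k _; rewrite coefD scalerDl.
Qed.

Lemma polyopZ c P T v : polyop (c *: P) T v = c *: polyop P T v.
Proof.
rewrite !(@polyopE (size P)) ?size_scale_leq // scaler_sumr.
by apply: eq_bigr => k _; rewrite coefZ scalerA.
Qed.

Lemma polyopMX P T v : polyop (P * 'X) T v = polyop P T (T v).
Proof.
rewrite !(@polyopE (size P).+1) ?leqnSn //; last first.
  by rewrite (leq_trans (size_polyMleq _ _)) // size_polyX addn2.
rewrite big_ord_recl big_ord_recr /= coefMX /= scale0r add0r.
rewrite [P`_(size P)]nth_default // scale0r addr0.
by apply: eq_bigr => k _; rewrite coefMX /= -iterSr.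
Qed.

Lemma polyopC c T v : polyop c%:P T v = c *: v.
Proof. by rewrite (@polyopE 1) ?size_polyC_leq1 // big_ord1 coefC. Qed.

Variable L : {linear V -> V}.

Lemma iter_linear k : linear (iter k L).
Proof. by move=> a u v; elim: k => //= k ->; rewrite linearP. Qed.

Lemma polyop_linear P : linear (polyop P L).
Proof.
move=> a u v; rewrite scaler_sumr -big_split; apply: eq_bigr => k _ /=.
by rewrite iter_linear scalerDr !scalerA mulrC.
Qed.
HB.instance Definition _ P := GRing.isLinear.Build F V V *:%R (polyop P L)
  (polyop_linear P).

(** A polynomial that vanishes to high order at [c] kills the generalised
    eigenvectors of [L] for [c]. *)
Lemma polyop_dvdp_eq0 P (c : F) N v :
  ('X - c%:P) ^+ N %| P -> iter N (fun w => L w - c *: w) v = 0 ->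
  polyop P L v = 0.
Proof.
case/dvdpP=> Q ->; elim: N v => [|N IH] v.
  by move=> /= ->; rewrite linear0.
rewrite iterSr => /IH <-; rewrite exprSr mulrA; set R := Q * _.
have ->: R * ('X - c%:P) = R * 'X + (- c) *: R.
  by rewrite mulrBr scaleNr -mul_polyC [c%:P * _]mulrC.
by rewrite polyopD polyopMX polyopZ scaleNr linearB [X in _ = _ - X]linearZ.
Qed.

End PolynomialOfOperator.

(** * The semisimple part of a matrix, with conjugated eigenvalues *)

Section Commutator.
Variables (F : fieldType) (n : nat).
Implicit Types A X : 'M[F]_n.

Definition commutator A X := A *m X - X *m A.

Lemma commutator_linear A : linear (commutator A).
Proof.
move=> a X Y; rewrite /commutator mulmxDr mulmxDl -scalemxAr -scalemxAl.
by rewrite scalerBr opprD addrACA.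
Qed.
HB.instance Definition _ A := GRing.isLinear.Build F 'M[F]_n 'M[F]_n *:%R
  (commutator A) (commutator_linear A).

Lemma commutator_subZ A a b X :
  commutator A X - (a - b) *: X = (A - a%:M) *m X - X *m (A - b%:M).
Proof.
rewrite /commutator mulmxBl mulmxBr mul_scalar_mx mul_mx_scalar scalerBl.
by rewrite !opprB addrACA [RHS]addrACA; congr (_ + _); exact: addrC.
Qed.

Lemma mxtrace_commutator X Y B :
  \tr (commutator Y X *m B) = \tr (X *m commutator B Y).
Proof.
rewrite /commutator mulmxBl mulmxBr !raddfB /= !mulmxA.
by rewrite -[Y *m _ *m _]mulmxA (mxtrace_mulC Y).
Qed.

End Commutator.

Section CommutatorOfPolynomial.
Variables (F : fieldType) (n : nat).
Implicit Types (A W X Y Z : 'M[F]_n.+1) (q r P : {poly F}).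

(** If the columns of [Y] are generalised eigenvectors of [A] for [a], and the
    rows of [W] are such for [b], then [Y Z W] is a generalised eigenvector of
    the commutator with [A] for [a - b]: one application of the shifted
    commutator trades it for a difference of two terms with one more factor
    [A - a] on the left, or [A - b] on the right.  The exponents [i] and [j]
    record these factors. *)
Lemma iter_commutator_eq0 A a b N Y W : (A - a%:M) ^+ N * Y = 0 ->
  W * (A - b%:M) ^+ N = 0 -> forall Z k i j, (N + N <= i + j + k)%N ->
  iter k (fun X => commutator A X - (a - b) *: X)
    ((A - a%:M) ^+ i * Y * Z * W * (A - b%:M) ^+ j) = 0.
Proof.
move=> YN WN Z.
have YN' i : (N <= i)%N -> (A - a%:M) ^+ i * Y = 0.
  by move/subnK <-; rewrite exprD -mulrA YN mulr0.
have WN' i : (N <= i)%N -> W * (A - b%:M) ^+ i = 0.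
  by move/subnKC <-; rewrite exprD mulrA WN mul0r.
pose D X := commutator A X - (a - b) *: X.
have Dlin k : linear (iter k D).
  move=> c u v; elim: k => //= k ->; rewrite /D !commutator_subZ.
  rewrite mulmxDr [(c *: _ + _) *m _]mulmxDl -scalemxAr -scalemxAl.
  by rewrite scalerBr opprD addrACA.
elim=> [|k IH] i j.
  rewrite addn0 => Nij.
  have [Ni|iN] := leqP N i; first by rewrite YN' // !mul0r.
  rewrite -mulrA WN' ?mulr0 //.
  by rewrite -(leq_add2l N) (leq_trans Nij) // leq_add2r ltnW.
move=> Nij; rewrite -/D iterSr.
have -> : D ((A - a%:M) ^+ i * Y * Z * W * (A - b%:M) ^+ j) =
   (-1) *: ((A - a%:M) ^+ i * Y * Z * W * (A - b%:M) ^+ j.+1)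
   + (A - a%:M) ^+ i.+1 * Y * Z * W * (A - b%:M) ^+ j.
  rewrite /D commutator_subZ scaleN1r [RHS]addrC mulmxE.
  by rewrite [_ ^+ i.+1]exprS [_ ^+ j.+1]exprSr !mulrA.
by rewrite Dlin !IH ?scaler0 ?add0r // (leq_trans Nij) // ?addnS !addSn ?addnS.
Qed.

(** On the generalised eigenspaces of [A], [q] takes the scalar values [f a];
    hence its commutator takes on those of the commutator with [A] the values
    [f a - f b = f (a - b)], and is therefore obtained from the latter by
    interpolation.  Different pairs with the same difference give the same
    value because [f] is additive. *)
Lemma commutator_horner (f : {additive F -> F}) A s q :
  horner_mx A (\prod_(a <- s) ('X - a%:P)) = 0 ->
  {in s, forall a, ('X - a%:P) ^+ size s %| q - (f a)%:P} ->
  exists P, forall X, commutator (horner_mx A q) X = polyop P (commutator A) X.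
Proof.
move=> sA qP; set N := size s in qP *.
have kill r : {in s, forall a, ('X - a%:P) ^+ N %| r} -> horner_mx A r = 0.
  by move/dvdp_prod_XsubC_powers/dvdpP=> [u ->]; rewrite rmorphM /= sA mulr0.
have ex_e a : exists e, all (fun b => ('X - b%:P) ^+ N %| e - (b == a)%:R%:P) s.
  have [e eP] := interpolation_mod_powers s N (fun b => (b == a)%:R).
  by exists e; apply/allP.
pose e a := xchoose (ex_e a).
have eP a b : b \in s -> ('X - b%:P) ^+ N %| e a - (b == a)%:R%:P.
  by move: b; apply/allP: (xchooseP (ex_e a)).
(* E a is the projector onto the generalised eigenspace for a. *)
pose E a := horner_mx A (e a); pose t := undup s.
have E1 : \sum_(a <- t) E a = 1.
  apply/eqP; rewrite -subr_eq0 -rmorph_sum -(rmorph1 (horner_mx A)) -rmorphB.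
  apply/eqP/kill => b sb.
  have -> : 1 = \sum_(a <- t) (b == a)%:R%:P :> {poly F}.
    rewrite (bigD1_seq b) ?undup_uniq ?mem_undup //= eqxx big1 ?addr0 //.
    by move=> a; rewrite eq_sym => /negPf->.
  rewrite -sumrB; elim/big_rec: _ => [|a r _]; first exact: dvdp0.
  by apply: dvdp_add; apply: eP.
have AE a : a \in s -> (A - a%:M) ^+ N * E a = 0.
  move=> sa; have -> : A - a%:M = horner_mx A ('X - a%:P).
    by rewrite rmorphB /= horner_mx_X horner_mx_C.
  rewrite -rmorphXn -rmorphM; apply: kill => b sb.
  have [->|ba] := eqVneq b a; first exact: dvdp_mulr.
  by have := eP a b sb; rewrite (negPf ba) subr0; apply: dvdp_mull.
have qE a : a \in s -> horner_mx A q * E a = f a *: E a.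
  move=> sa; apply/eqP; rewrite -subr_eq0 -mul_scalar_mx -(horner_mx_C A) mulmxE.
  rewrite -mulrBl -rmorphB -rmorphM; apply/eqP/kill => b sb.
  have [->|ba] := eqVneq b a; first exact/dvdp_mulr/qP.
  by have := eP a b sb; rewrite (negPf ba) subr0; apply: dvdp_mull.
have Ecomm r a : E a * horner_mx A r = horner_mx A r * E a.
  by rewrite -!rmorphM mulrC.
have [P PP] := interpolation_mod_powers [seq a - b | a <- s, b <- s] (N + N) f.
exists P => X.
(* Both sides act as the scalar f (a - b) on each block E a * X * E b. *)
have -> : X = \sum_(a <- t) \sum_(b <- t) E a * X * E b.
  under eq_bigr do rewrite -mulr_sumr E1 mulr1.
  by rewrite -mulr_suml E1 mul1r.
rewrite !linear_sum !big_seq; apply: eq_bigr => a; rewrite mem_undup => sa.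
rewrite !linear_sum !big_seq; apply: eq_bigr => b; rewrite mem_undup => sb.
have -> : P = P - (f (a - b))%:P + (f (a - b))%:P by rewrite subrK.
rewrite /= polyopD polyopC (polyop_dvdp_eq0 (PP _ _)) ?add0r.
- rewrite /commutator mulmxE mulrA mulrA qE // -[_ * E b * _]mulrA Ecomm qE //.
  by rewrite -scalerAr -!scalerAl -scalerBl raddfB.
- by apply: allpairs_f.
have EA : E b * (A - b%:M) ^+ N = 0.
  rewrite -(AE b sb); have -> : A - b%:M = horner_mx A ('X - b%:P).
    by rewrite rmorphB /= horner_mx_X horner_mx_C.
  by rewrite -rmorphXn Ecomm.
have := iter_commutator_eq0 (AE a sa) EA X (leqnn (0 + 0 + (N + N))%N).
by rewrite !expr0 mul1r mulr1.
Qed.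

End CommutatorOfPolynomial.

Section ComplexMatrix.
Variables (C : numClosedFieldType) (n : nat).
Implicit Types (A B T : 'M[C]_n.+1) (q P : {poly C}).

Lemma mul_trig_mx A B : is_trig_mx A -> is_trig_mx B ->
  is_trig_mx (A *m B) /\ forall i, (A *m B) i i = A i i * B i i.
Proof.
move=> /is_trig_mxP tA /is_trig_mxP tB; split=> [|i].
  apply/is_trig_mxP => i j ij; rewrite mxE big1 // => k _.
  have [ik|ki] := ltnP i k; first by rewrite tA ?mul0r.
  by rewrite tB ?mulr0 // (leq_ltn_trans ki).
rewrite mxE (bigD1 i) //= big1 ?addr0 // => k ki.
have [ik|] := ltnP i k; first by rewrite tA ?mul0r.
rewrite -val_eqE /= in ki.
by rewrite leq_eqVlt (negPf ki) /= => ik; rewrite tB ?mulr0.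
Qed.

Lemma horner_trig_mx T q : is_trig_mx T ->
  is_trig_mx (horner_mx T q) /\ forall i, horner_mx T q i i = q.[T i i].
Proof.
move=> tT; elim/poly_ind: q => [|q c [tq dq]].
  by rewrite rmorph0 mx0_is_trig; split=> // i; rewrite horner0 mxE.
rewrite rmorphD rmorphM /= horner_mx_X horner_mx_C.
have [/is_trig_mxP tqT dqT] := mul_trig_mx tq tT; split=> [|i].
  apply/is_trig_mxP => i j ij; rewrite mxE tqT // add0r mxE.
  by rewrite -val_eqE ltn_eqF.
by rewrite mxE dqT dq mxE eqxx hornerMXaddC.
Qed.

(** After triangularisation the eigenvalues are the diagonal entries, and the
    product of [A] with the matrix of conjugated eigenvalues has their squared
    moduli on the diagonal. *)
Lemma complex_conj_semisimple_part A : exists q P,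
  [/\ forall X, commutator (horner_mx A q) X = polyop P (commutator A) X,
      0 <= \tr (A *m horner_mx A q) &
      \tr (A *m horner_mx A q) = 0 -> A ^+ n.+1 = 0].
Proof.
have [V /unitarymx_unit Vu] := @Schur _ _ A (ltn0Sn n).
rewrite /similar_to mxred.conjumx // => tT; set T := V *m A *m invmx V in tT.
have AT : A = invmx V *m T *m V by rewrite /T !mulmxA mulVmx // mul1mx mulmxKV.
pose s := [seq T i i | i : 'I_n.+1].
have sT : \prod_(a <- s) ('X - a%:P) = char_poly T.
  by rewrite char_poly_trig // big_map big_enum.
have hA r : horner_mx A r = invmx V *m horner_mx T r *m V.
  by rewrite AT horner_mx_uconjC.
have [q qP] := interpolation_mod_powers s (size s) Num.conj.
have sA : horner_mx A (\prod_(a <- s) ('X - a%:P)) = 0.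
  by rewrite hA sT Cayley_Hamilton mulmx0 mul0mx.
have [P qPP] := commutator_horner sA qP.
have trE : \tr (A *m horner_mx A q) = \sum_i `|T i i| ^+ 2.
  rewrite hA {1}AT 2!mulmxA mulmxK // -mulmxA mulmxA mxtrace_mulC.
  rewrite !mulmxA mulmxV // mul1mx.
  have [tq dq] := horner_trig_mx q tT; apply: eq_bigr => i _.
  rewrite (mul_trig_mx tT tq).2 dq normCK; congr (_ * _).
  have si : T i i \in s by apply/imageP; exists i.
  apply/eqP; rewrite -subr_eq0.
  have -> : q.[T i i] - (T i i)^* = (q - ((T i i)^*)%:P).[T i i].
    by rewrite hornerD hornerN hornerC.
  rewrite -/(root _ _) -dvdp_XsubCl; apply: dvdp_trans (qP _ si).
  by rewrite dvdp_exp // size_map -cardE card_ord.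
exists q, P; rewrite trE; split=> // [|/eqP].
  by apply: sumr_ge0 => i _; rewrite exprn_ge0.
rewrite psumr_eq0 => [/allP s0|i _]; last by rewrite exprn_ge0.
have : horner_mx T (char_poly T) = 0 by apply: Cayley_Hamilton.
have -> : char_poly T = 'X ^+ n.+1.
  rewrite char_poly_trig // (eq_bigr (fun=> 'X)) ?prodr_const ?card_ord // => i _.
  have := s0 i (mem_index_enum i); rewrite /= expf_eq0 normr_eq0 => /eqP->.
  by rewrite subr0.
move=> T0; rewrite -(horner_mx_X A) -rmorphXn /=.
by rewrite hA T0 mulmx0 mul0mx.
Qed.

End ComplexMatrix.

Section RealMatrix.
Variables (R : rcfType) (n : nat).
Implicit Types (A B X : 'M[R]_n.+1).
Local Notation toC := (real_complex R).
Local Notation Re := (@complex.Re R).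
Local Notation reM := (map_mx Re).

Let Re0 : Re (0 : R[i]) = 0. Proof. by []. Qed.
Let ReD (x y : R[i]) : Re (x + y) = Re x + Re y.
Proof. by case: x y => a b [c d]. Qed.
Let ReN (x : R[i]) : Re (- x) = - Re x. Proof. by case: x. Qed.
Let ReMr (x : R[i]) a : Re (x * toC a) = Re x * a.
Proof. by case: x => x y; rewrite /= mulr0 subr0. Qed.
Let ReMl (x : R[i]) a : Re (toC a * x) = a * Re x.
Proof. by rewrite mulrC ReMr mulrC. Qed.
Let Re_sum := big_morph Re ReD Re0.

(** Taking real parts of the matrix and of the coefficients of the polynomial
    is compatible with products by real matrices. *)
Lemma real_conj_semisimple_part A : exists B (P : {poly R}),
  (forall X, commutator B X = polyop P (commutator A) X) /\
  (\tr (A *m B) = 0 -> A ^+ n.+1 = 0).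
Proof.
have [q [P [qP tr_ge0 tr_eq0]]] := complex_conj_semisimple_part (map_mx toC A).
set y := horner_mx _ q in qP tr_ge0 tr_eq0.
have reMl X : reM (map_mx toC X *m y) = X *m reM y.
  apply/matrixP => i j; rewrite !mxE Re_sum.
  by apply: eq_bigr => k _; rewrite !mxE ReMl.
have reMr X : reM (y *m map_mx toC X) = reM y *m X.
  apply/matrixP => i j; rewrite !mxE Re_sum.
  by apply: eq_bigr => k _; rewrite !mxE ReMr.
exists (reM y), (\poly_(k < size P) Re P`_k); split=> [X|tr0].
  have /(congr1 reM) := qP (map_mx toC X).
  have -> : reM (commutator y (map_mx toC X)) = commutator (reM y) X.
    rewrite /commutator -reMl -reMr; apply/matrixP => i j.
    by rewrite 6!mxE ReD ReN !mxE.
  move->; rewrite [RHS](@polyopE _ _ (size P)) ?size_poly // /polyop.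
  have iterC k : iter k (commutator (map_mx toC A)) (map_mx toC X) =
      map_mx toC (iter k (commutator A) X).
    by elim: k => //= k ->; rewrite /commutator raddfB /= !map_mxM.
  apply/matrixP => i j; rewrite mxE summxE Re_sum summxE; apply: eq_bigr => k _.
  by rewrite iterC !mxE ReMr coef_poly ltn_ord.
have trRe : \tr (A *m reM y) = Re (\tr (map_mx toC A *m y)).
  by rewrite -reMl /mxtrace Re_sum; apply: eq_bigr => i _; rewrite mxE.
have: map_mx toC A ^+ n.+1 = 0.
  apply: tr_eq0; move: (ger0_Im tr_ge0) trRe; rewrite tr0.
  by case: (\tr _) => a b /= -> <-.
by rewrite -rmorphXn -(map_mx0 toC) => /map_mx_inj.
Qed.

End RealMatrix.

Lemma conj_semisimple_part (R : rcfType) n (A : 'M[R]_n) :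
  exists B (P : {poly R}),
  (forall X, commutator B X = polyop P (commutator A) X) /\
  (\tr (A *m B) = 0 -> A ^+ n.+1 = 0).
Proof.
case: n A => [A|n A]; last first.
  have [B [P [BP trB]]] := real_conj_semisimple_part A.
  by exists B, P; split=> // /trB An; rewrite exprS An mulr0.
by exists 0, 0; split=> *; apply/matrixP=> -[].
Qed.

(** * Brackets of subspaces, the derived series and Engel's theorem *)

Section LieBasics.
Variables (K : fieldType) (g : lieAlgType K).
Implicit Types (x y z v w : g) (U V W J : {vspace g}).

Lemma lie0r x : [lie x, 0] = 0. Proof. exact: linear0. Qed.
Lemma lie0l x : [lie 0, x] = 0. Proof. by rewrite lieC lie0r oppr0. Qed.
Lemma lieNr x y : [lie x, - y] = - [lie x, y]. Proof. exact: linearN. Qed.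
Lemma lieNl x y : [lie - x, y] = - [lie x, y].
Proof. by rewrite lieC lieNr opprK lieC. Qed.
Lemma lieBr x y z : [lie x, y - z] = [lie x, y] - [lie x, z].
Proof. exact: linearB. Qed.

Lemma lie_leibniz x y z :
  [lie x, [lie y, z]] = [lie [lie x, y], z] + [lie y, [lie x, z]].
Proof.
apply/eqP; rewrite -subr_eq0 opprD addrA -(lie_jacobi x y z).
by rewrite (lieC [lie x, y] z) (lieC x z) lieNr !opprK addrAC.
Qed.

(** A linear combination of brackets is a sum of brackets, so closure under
    scaling need not be checked. *)
Lemma liev_ind U V (P : g -> Prop) : P 0 ->
  (forall x y, P x -> P y -> P (x + y)) ->
  (forall x y, x \in U -> y \in V -> P [lie x, y]) ->
  forall x, x \in liev U V -> P x.
Proof.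
move=> P0 PD PUV x; rewrite /liev -[allpairs _ _ _]in_tupleE => /coord_span->.
apply: big_ind => // i _; set X := in_tuple _.
have /allpairsP[[u v] /= [Uu Vv ->]] :
    X`_i \in allpairs lie (vbasis U) (vbasis V) by exact/mem_nth.
by rewrite -lieZl; apply: PUV (vbasis_mem Vv); apply/memvZ/vbasis_mem.
Qed.

Lemma lievS U1 U2 V1 V2 : (U1 <= U2)%VS -> (V1 <= V2)%VS ->
  (liev U1 V1 <= liev U2 V2)%VS.
Proof.
move=> /subvP sU /subvP sV; apply/liev_subP=> x y /sU ? /sV ?.
exact: memv_lie.
Qed.

Lemma derived_series_stationary U : (liev U U <= U)%VS ->
  exists2 n, (derived_series n U <= U)%VS &
    liev (derived_series n U) (derived_series n U) = derived_series n U.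
Proof.
move=> sUU; pose D n := derived_series n U.
have DS n : (D n.+1 <= D n)%VS by elim: n => //= n IH; apply: lievS.
have DU n : (D n <= U)%VS by elim: n => [|n] //=; apply/subv_trans/DS.
suff [n Dn] : exists n, D n.+1 = D n by exists n; [apply: DU | apply: Dn].
have dimD n : (exists n, D n.+1 = D n) \/ (\dim (D n) + n <= \dim U)%N.
  elim: n => [|n [|IH]]; [by right; rewrite addn0 | by left |].
  have [Dn|nDn] := eqVneq (D n.+1) (D n); [by left; exists n | right].
  rewrite addnS -addSn (leq_trans _ IH) // leq_add2r.
  by rewrite ltn_neqAle !(dimv_leqif_eq (DS n)) nDn.
by have [//|] := dimD (\dim U).+1; rewrite addnS ltnNge leq_addl.
Qed.

(** The conclusion of Engel's theorem for the action of [J] on the quotient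
    [W / U]: a nonzero vector killed by [J]. *)
Definition engel J : Prop := forall U W, (U <= W)%VS -> ~~ (W <= U)%VS ->
  (forall x w, x \in J -> w \in W -> [lie x, w] \in W) ->
  (forall x u, x \in J -> u \in U -> [lie x, u] \in U) ->
  exists w, [/\ w \in W, w \notin U & forall x, x \in J -> [lie x, w] \in U].

(** Starting from [w] killed by [J] modulo [U], take the last iterate of [v] on
    [w] outside [U]: since [v] normalises [J], all iterates are killed by [J],
    and the last one is killed by [v] as well. *)
Lemma engel_add_line J v N : (forall x, x \in J -> [lie x, v] \in J) ->
  (forall w, iter N (lie v) w = 0) -> engel J -> engel (J + <[v]>)%VS.
Proof.
move=> Jv vN EJ U W sUW nWU JW JU.
have sJ x : x \in J -> x \in (J + <[v]>)%VS by apply/subvP/addvSl.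
have Lv : v \in (J + <[v]>)%VS by apply: (subvP (addvSr _ _)); apply: memv_line.
have [w [Ww nUw Jw]] := EJ U W sUW nWU (fun x w Jx => JW x w (sJ x Jx))
  (fun x w Jx => JU x w (sJ x Jx)).
have wk k : iter k (lie v) w \in W /\
    forall x, x \in J -> [lie x, iter k (lie v) w] \in U.
  elim: k => //= k [Wk Jk]; split=> [|x Jx]; first exact: JW.
  by rewrite lie_leibniz memvD ?Jk ?Jv // JU // Jk.
have ex_k : exists k, iter k (lie v) w \in U by exists N; rewrite vN mem0v.
case: (ex_minnP ex_k) => -[|k] Uk kmin; first by rewrite Uk in nUw.
exists (iter k (lie v) w); split; first exact: (wk k).1.
  by apply/negP=> /kmin; rewrite ltnn.
move=> _ /memv_addP[x Jx [_ /vlineP[c ->] ->]].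
by rewrite lieDl lieZl memvD ?memvZ // (wk k).2.
Qed.

(** Subalgebras [H] of [J] with the Engel property grow one dimension at a time:
    a vector of [J / H] killed by [H] is a [v] that normalises [H], and
    [H + <[v]>] has its brackets in [H].  So no member of this chain other than
    zero is perfect, and the last one is [J]. *)
Lemma engel_perfect_eq0 J N : liev J J = J ->
  (forall x w, x \in J -> iter N (lie x) w = 0) -> J = 0%VS.
Proof.
move=> JJ Jnil.
suff chain k : (k <= \dim J)%N -> exists H, [/\ (H <= J)%VS, \dim H = k,
    (liev H H <= H)%VS, engel H & liev H H = H -> H = 0%VS].
  have [H [HJ dH _ _ H0]] := chain _ (leqnn _).
  have HJ' : H = J by apply/eqP; rewrite eqEdim HJ dH leqnn.
  by rewrite HJ' in H0; apply: H0.
elim: k => [_|k IH ltk].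
  exists 0%VS; rewrite sub0v dimv0; split=> //.
    by apply/liev_subP=> x y; rewrite memv0 => /eqP-> _; rewrite lie0l mem0v.
  move=> U W _ /subvPn[w Ww nUw] _ _; exists w; split=> // x.
  by rewrite memv0 => /eqP->; rewrite lie0l mem0v.
have [H [HJ dH HH0 EH _]] := IH (ltnW ltk); have HH := liev_subP _ _ _ HH0.
have nJH : ~~ (J <= H)%VS.
  by apply: contraL ltk => /dimvS; rewrite dH -leqNgt.
have stabJ x w : x \in H -> w \in J -> [lie x, w] \in J.
  by move=> /(subvP HJ) Jx Jw; rewrite -JJ memv_lie.
have [v [Jv nHv Hv]] := EH H J HJ nJH stabJ HH.
have LH : (liev (H + <[v]>) (H + <[v]>) <= H)%VS.
  apply/liev_subP=> _ _ /memv_addP[x Hx [_ /vlineP[a ->] ->]]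
    /memv_addP[y Hy [_ /vlineP[b ->] ->]].
  rewrite !(lieDl, lieDr, lieZl, lieZr) lie_alt !scaler0 addr0.
  have Hvy : [lie v, y] \in H by rewrite lieC memvN Hv.
  by do ![done | apply: memvD | apply: memvZ | apply: Hv | apply: HH].
exists (H + <[v]>)%VS; split.
- by rewrite subv_add HJ -memvE.
- rewrite dimv_disjoint_sum; last first.
    apply/eqP; rewrite -subv0; apply/subvP=> u /memv_capP[Hu /vlineP[c uv]].
    rewrite memv0 uv; have [->|c0] := eqVneq c 0; first by rewrite scale0r.
    by case/negP: nHv; rewrite -(scalerK c0 v) -uv memvZ.
  by rewrite dH dim_vline addnC; case: eqP nHv => // ->; rewrite mem0v.
- by apply: subv_trans LH (addvSl _ _).
- by apply: engel_add_line EH => // w; apply: Jnil.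
move=> LL; rewrite LL in LH; case/negP: nHv; apply: (subvP LH).
by apply: (subvP (addvSr _ _)); apply: memv_line.
Qed.

End LieBasics.

(** * The Killing form and Cartan's criterion *)

Lemma notin_functional (K : fieldType) (V : vectType K) (U : {vspace V}) v :
  v \notin U -> exists2 f : 'Hom(V, K^o),
    f v != 0 & {in U, forall u, f u = 0}.
Proof.
move=> nUv; pose c := v2r (v - projv U v).
have /rV0Pn[i ci] : c != 0.
  rewrite raddf_eq0; last exact: v2r_inj.
  by rewrite subr_eq0; apply: contraNneq nUv => ->; apply: memv_proj.
pose f w : K^o := v2r (w - projv U w) 0 i.
have f_lin : linear f.
  move=> a x y; rewrite /f (linearP (projv U)) opprD addrACA -scalerBr.
  by rewrite linearP !mxE.
pose F := GRing.isLinear.Build K V K^o *:%R f f_lin.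
pose f' : {linear V -> K^o} := HB.pack f F.
exists (linfun f') => [|u Uu]; rewrite lfunE //=.
by rewrite /f projv_id // subrr linear0 mxE.
Qed.

Section Killing.
Variables (K : fieldType) (g : lieAlgType K).
Implicit Types (x y z v w : g) (U V W J : {vspace g}).

(** Matrices act on the right of row vectors, so [admx] reverses brackets
    ([admx_lie]). *)
Definition admx x : 'M[K]_(dim g) := lin1_mx (v2r \o lie x \o r2v).

Lemma mul_admx (u : 'rV_(dim g)) x : u *m admx x = v2r [lie x, r2v u].
Proof. by rewrite mul_rV_lin1. Qed.

Lemma admx_linear : linear admx.
Proof.
move=> a x y; apply/row_matrixP => i.
by rewrite !rowE mulmxDr -scalemxAr !mul_admx lieDl lieZl linearP.
Qed.
HB.instance Definition _ :=
  GRing.isLinear.Build K g 'M[K]_(dim g) *:%R admx admx_linear.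

Lemma admx_lie x y : admx [lie x, y] = commutator (admx y) (admx x).
Proof.
apply/row_matrixP => i; rewrite !rowE mulmxBr !mulmxA !mul_admx !v2rK -linearB.
by rewrite (lie_leibniz x) addrK.
Qed.

Lemma polyop_admx P a x : polyop P (commutator (admx a)) (admx x) =
  admx (polyop P (fun z => [lie z, a]) x).
Proof.
have iterE k : iter k (commutator (admx a)) (admx x) =
    admx (iter k (fun z => [lie z, a]) x).
  by elim: k => //= k ->; rewrite admx_lie.
by rewrite /polyop linear_sum; apply: eq_bigr => k _; rewrite iterE linearZ.
Qed.

Lemma admx_nilpotent x N : admx x ^+ N = 0 -> forall w, iter N (lie x) w = 0.
Proof.
move=> xN w; have iterE k u : u *m admx x ^+ k = v2r (iter k (lie x) (r2v u)).
  elim: k u => [|k IH] u; first by rewrite expr0 mulmx1 r2vK.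
  by rewrite exprS mulmxA IH mul_admx v2rK -iterSr.
by apply/(@v2r_inj _ g); rewrite -[w in LHS]v2rK -iterE xN mulmx0 linear0.
Qed.

Definition killing x y : K^o := \tr (admx x *m admx y).

Lemma killingC x y : killing x y = killing y x.
Proof. exact: mxtrace_mulC. Qed.

Lemma killing_lie x y z : killing [lie x, y] z = killing x [lie y, z].
Proof.
by rewrite /killing !admx_lie mxtrace_commutator.
Qed.

Lemma killing_linear x : linear (killing x).
Proof.
by move=> a y z; rewrite /killing linearP mulmxDr -scalemxAr mxtraceD mxtraceZ.
Qed.
HB.instance Definition _ x :=
  GRing.isLinear.Build K g K^o *:%R (killing x) (killing_linear x).

Definition killing_form x : 'Hom(g, K^o) := linfun (killing x).

Lemma killing_form_linear : linear killing_form.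
Proof.
move=> a x y; apply/lfunP => z; rewrite add_lfunE scale_lfunE !lfunE /=.
by rewrite killingC linearP /= !(killingC z).
Qed.
HB.instance Definition _ :=
  GRing.isLinear.Build K g 'Hom(g, K^o) *:%R killing_form killing_form_linear.

(** Each bracket [[x, y]] contributes the trace of [ad x] times a commutator of
    [B] with [ad y], which is [ad y'] for some [y'] in [J] by the hypothesis on
    [B]: a value of the Killing form on [J]. *)
Lemma mxtrace_admx_perfect (B : 'M[K]_(dim g)) (P : {poly K}) J a :
  (forall X, commutator B X = polyop P (commutator (admx a)) X) ->
  liev J J = J -> (forall x y, x \in J -> y \in J -> killing x y = 0) ->
  a \in J -> \tr (admx a *m B) = 0.
Proof.
move=> BP JJ J0 Ja; have: a \in liev J J by rewrite JJ.
have JP y : y \in J -> polyop P (fun z => [lie z, a]) y \in J.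
  move=> Jy; apply: memv_suml => k _; apply: memvZ.
  by elim: (val k) => //= m Jm; rewrite -JJ memv_lie.
apply: (liev_ind (P := fun x => \tr (admx x *m B) = 0)) => [|x y x0 y0|x y Jx Jy].
- by rewrite linear0 mul0mx mxtrace0.
- by rewrite linearD mulmxDl mxtraceD x0 y0 addr0.
by rewrite admx_lie mxtrace_commutator BP polyop_admx; apply/J0/JP.
Qed.

Definition lie_perfect := liev fullv fullv = fullv :> {vspace g}.
Definition lie_centerless := forall x, (forall y, [lie x, y] = 0) -> x = 0.

Definition nondegenerate_killing := forall x, killing_form x = 0 -> x = 0.

Lemma killing_centerless : nondegenerate_killing -> lie_centerless.
Proof.
move=> nd x x0; apply: nd; apply/lfunP => y; rewrite zero_lfunE lfunE /=.
suff x0' : admx x = 0 by rewrite /killing x0' mul0mx mxtrace0.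
by apply/row_matrixP => i; rewrite rowE mul_admx x0 linear0 row0.
Qed.

Lemma killing_form_onto : nondegenerate_killing ->
  forall f, exists x, f = killing_form x.
Proof.
move=> nd f; pose Phi := linfun killing_form.
have kPhi : (fullv :&: lker Phi = 0)%VS.
  apply/eqP; rewrite capfv -subv0; apply/subvP => x.
  by rewrite memv_ker lfunE memv0 => /eqP /nd ->.
have : limg Phi = fullv.
  apply/eqP; rewrite eqEdim subvf limg_dim_eq // !dimvf /dim /=.
  by rewrite muln1.
by move=> PhiT; have /memv_imgP[x _ ->] : f \in limg Phi;
  [rewrite PhiT memvf | exists x; rewrite lfunE].
Qed.

(** If [g] is not perfect, a nonzero functional vanishes on the brackets; it is
    the Killing product with some [x], and invariance makes [x] central. *)
Lemma killing_perfect : nondegenerate_killing -> lie_perfect.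
Proof.
move=> nd; apply/eqP; rewrite eqEsubv subvf /=; apply/negPn/negP.
case/subvPn => v _ /notin_functional[f fv f0]; case/eqP: fv.
have [x fx] := killing_form_onto nd f.
suff x0 : x = 0 by rewrite fx x0 linear0 zero_lfunE.
apply: (killing_centerless nd) => y; apply: nd; apply/lfunP => z.
rewrite zero_lfunE lfunE /= killing_lie.
by have := f0 _ (memv_lie (memvf y) (memvf z)); rewrite fx lfunE.
Qed.
End Killing.

(** Cartan's criterion: the Killing form of a Lie algebra with zero radical is
    nondegenerate. *)
Theorem semisimple_killing (R : rcfType) (g : lieAlgType R) :
  semisimple g -> nondegenerate_killing g.
Proof.
move=> ss x x0; pose I := lker (linfun (@killing_form R g)).
have IP z : z \in I <-> killing_form z = 0.
  by rewrite memv_ker lfunE; split=> /eqP.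
have idI : lie_ideal I.
  move=> y z /IP z0; apply/IP/lfunP => w; rewrite zero_lfunE lfunE /=.
  rewrite lieC -lieNr killing_lie.
  by have /lfunP/(_ [lie - y, w]) := z0; rewrite lfunE zero_lfunE.
have /(derived_series_stationary)[n DnI DnD] : (liev I I <= I)%VS.
  by apply/liev_subP => y z _; apply: idI.
suff I0 : I = 0%VS by apply/eqP; rewrite -memv0 -I0; apply/IP.
apply: ss => //; exists n.
apply: (engel_perfect_eq0 DnD (N := (dim g).+1)) => y w Jy.
apply: admx_nilpotent; have [B [P [BP]]] := conj_semisimple_part (admx y); apply.
apply: mxtrace_admx_perfect BP DnD _ Jy => u v /(subvP DnI) /IP u0 _.
by have /lfunP/(_ v) := u0; rewrite lfunE zero_lfunE.
Qed.

(** * The cotangent Lie algebra of a semisimple Lie algebra *)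

Section Cotangent.
Variables (K : fieldType) (g : lieAlgType K).

Lemma cotangent_centerless : lie_perfect g -> lie_centerless g ->
  lie_centerless (cotangent g).
Proof.
move=> gP gZ [x f] xf0.
have x0 : x = 0.
  by apply: gZ => y; have := congr1 fst (xf0 ((y, 0) : cotangent g)).
have f0 : f = 0.
  apply/lfunP => z; have: z \in liev fullv fullv by rewrite gP memvf.
  apply: (liev_ind (P := fun z => f z = (0 : 'Hom(g, K^o)) z)).
  - by rewrite !linear0.
  - by move=> u v fu fv; rewrite !linearD /= fu fv.
  move=> u v _ _; have := xf0 ((u, 0) : cotangent g).
  move/(congr1 (fun p : cotangent g => p.2 v)).
  rewrite cotangent_lie2E /= !zero_lfunE subr0; exact.
by rewrite x0 f0.
Qed.

(** The ideal [g^*] is reached because every form is the Killing product with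
    some [[y, z]], which by invariance is the coadjoint image under [- z] of the
    Killing product with [y]. *)
Lemma cotangent_perfect : nondegenerate_killing g -> lie_perfect (cotangent g).
Proof.
move=> nd; have gP := killing_perfect nd.
apply/vspaceP => -[x f]; rewrite memvf; set W := liev _ _.
have inW (u v : cotangent g) : [lie u, v] \in W by apply: memv_lie; apply: memvf.
have memg y : y \in liev (@fullv _ g) fullv by rewrite gP memvf.
have Wg : ((x, 0) : cotangent g) \in W.
  apply: (liev_ind (P := fun y => (y, 0) \in W) _ _ _ (memg x)).
  - exact: mem0v.
  - move=> y z Wy Wz; have := memvD Wy Wz.
    by congr (_ \in W); rewrite /GRing.add /= /add_pair /= addr0.
  - move=> y z _ _; have := inW (y, 0) (z, 0).
    by rewrite cotangent_lieE /coad /= !comp_lfun0l oppr0 subr0.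
have [a ->] := killing_form_onto nd f.
have Wd : ((0, killing_form a) : cotangent g) \in W.
  apply: (liev_ind (P := fun y => (0, killing_form y) \in W) _ _ _ (memg a)).
  - by rewrite linear0 mem0v.
  - move=> y z Wy Wz; have := memvD Wy Wz.
    by congr (_ \in W); rewrite /GRing.add /= /add_pair /= addr0 linearD.
  - move=> y z _ _; have := inW (- z, 0) (0, killing_form y).
    congr (_ \in W); rewrite cotangent_lieE /= lie0r; congr (_, _).
    apply/lfunP => w; rewrite add_lfunE coadE [X in _ + X]opp_lfunE coadE.
    rewrite zero_lfunE !lfunE /=.
    by rewrite oppr0 subr0 killing_lie lieNl linearN opprK.
have := memvD Wg Wd.
by congr (_ \in W); rewrite /GRing.add /= /add_pair /= addr0 add0r.
Qed.
End Cotangent.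

(** * Prederivations of perfect centreless Lie algebras *)

(** The maps [d] and [e = p - d] appear as the relations [D] and [E];
    the trivial centre makes them functional and perfectness makes them total. *)
Lemma prederivation_derivation (K : fieldType) (L : lieAlgType K) (p : 'End(L)) :
  (2%:R : K) != 0 -> lie_perfect L -> lie_centerless L ->
  prederivation p -> derivation p.
Proof.
move=> K2 LP LZ pP.
pose D x d := forall z, p [lie z, x] = [lie p z, x] + [lie z, d].
have uniqD x d1 d2 : D x d1 -> D x d2 -> d1 = d2.
  move=> D1 D2; apply/eqP; rewrite -subr_eq0; apply/eqP/LZ => z.
  have := D2 z; rewrite D1 => /addrI zd.
  by rewrite lieC lieBr zd subrr oppr0.
have DD x y d1 d2 : D x d1 -> D y d2 -> D (x + y) (d1 + d2).
  by move=> D1 D2 z; rewrite !lieDr linearD /= D1 D2 addrACA.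
have Dlie x y : D [lie x, y] ([lie p x, y] + [lie x, p y]).
  by move=> z; rewrite pP lieDr addrA.
have exD x : exists d, D x d.
  have: x \in liev fullv fullv by rewrite LP memvf.
  apply: (liev_ind (P := fun x => exists d, D x d))
    => [|y z [d1 D1] [d2 D2]|y z _ _].
  - by exists 0 => z; rewrite !lie0r linear0 addr0.
  - by exists (d1 + d2); apply: DD.
  - by exists ([lie p y, z] + [lie y, p z]); apply: Dlie.
pose E x e := D x (p x - e).
have exE x : exists e, E x e.
  by have [d Dd] := exD x; exists (p x - d); rewrite /E opprB addrC subrK.
have uniqE x e1 e2 : E x e1 -> E x e2 -> e1 = e2.
  by move=> E1 E2; apply/oppr_inj/(addrI (p x))/(uniqD x).
have EE x e z : E x e ->
    p [lie z, x] = [lie p z, x] + [lie z, p x] - [lie z, e].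
  by move=> Ex; rewrite Ex lieBr addrA.
have Elie x e z : E x e -> E [lie z, x] (- [lie z, e]).
  move=> Ex; rewrite /E (EE _ _ _ Ex) opprK subrK; exact: Dlie.
have Eadd x y e1 e2 : E x e1 -> E y e2 -> E (x + y) (e1 + e2).
  by move=> E1 E2; have := DD _ _ _ _ E1 E2; rewrite /E linearD /= opprD addrACA.
have e0 x e : E x e -> e = 0.
  move=> Ex; apply: LZ => w; have: w \in liev fullv fullv by rewrite LP memvf.
  apply: (liev_ind (P := fun w => [lie e, w] = 0)) => [|u v u0 v0|u v _ _].
  - exact: lie0r.
  - by rewrite lieDr u0 v0 addr0.
  (* Two values of e at [u, [v, x]], one on each side of the Jacobi identity. *)
  have E1 := Elie _ _ u (Elie _ _ v Ex).
  have E2 : E [lie u, [lie v, x]]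
              (- [lie [lie u, v], e] + - [lie v, - [lie u, e]]).
    by rewrite lie_leibniz; apply: Eadd; [apply: Elie | apply/Elie/Elie].
  have /eqP := uniqE _ _ _ E1 E2.
  rewrite !lieNr !opprK lie_leibniz -subr_eq0 opprD opprK addrACA subrr addr0.
  rewrite -mulr2n -scaler_nat scaler_eq0 (negPf K2) /= => /eqP uve.
  by rewrite lieC uve oppr0.
move=> z x; have [e Ex] := exE x.
by rewrite (EE _ _ _ Ex) (e0 _ _ Ex) lie0r subr0.
Qed.

Theorem theoremC (R : realType) (g : lieAlgType R) (p : 'End(cotangent g)) :
  semisimple g -> prederivation p -> derivation p.
Proof.
move=> /semisimple_killing nd; apply: prederivation_derivation.
- by rewrite pnatr_eq0.
- exact: cotangent_perfect.
- exact: cotangent_centerless (killing_perfect nd) (killing_centerless nd).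
Qed.
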